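(* The relation algebra $3_7$ is representable over $\mathbb{Z}/n\mathbb{Z}$ for every even $n\geq 6$, and $\mathrm{CySp}(3_7)=\{2k : k\geq 3\}$ (where $k$ ranges over integers).
   Context: $3_7$ is the finite symmetric integral relation algebra with three atoms $1'$ (identity), $a$, $b$ (all symmetric, i.e. self-converse) whose mandatory diversity cycles (up to equivalence) among $aaa$, $bbb$, $abb$, $baa$ are exactly $bbb$ and $abb$; the others are forbidden. Equivalently its composition is $a;a=1'$, $b;b=1'+a+b$, $a;b=b;a=b$. For a positive integer $n$, a representation of $3_7$ over the cyclic group $\mathbb{Z}/n\mathbb{Z}$ is a partition of $\mathbb{Z}/n\mathbb{Z}$ into $\mathrm{Id}=\{0\}$ and two nonempty sets $A,B$ with $A=-A$, $B=-B$, such that $A+A=\mathrm{Id}$, $B+B=A\cup B\cup\mathrm{Id}$, and $A+B=B$, where $X+Y=\{x+y : x\in X,\ y\in Y\}$ (addition modulo $n$). The algebra is representable over $\mathbb{Z}/n\mathbb{Z}$ if such a partition exists. The cyclic spectrum is $\mathrm{CySp}(3_7)=\{n : n \text{ a positive integer and } 3_7 \text{ is representable over } \mathbb{Z}/n\mathbb{Z}\}$. *)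

(* Defs.v *)
From mathcomp Require Import classical_sets.
From mathcomp Require Import all_boot all_algebra.

Set Implicit Arguments.
Unset Strict Implicit.
Unset Printing Implicit Defensive.

Import GRing.Theory.

Local Open Scope ring_scope.
Local Open Scope set_scope.

Definition sumset (G : finZmodType) (X Y : {set G}) : {set G} :=
  [set x + y | x in X, y in Y].

Definition oppset (G : finZmodType) (X : {set G}) : {set G} :=
  [set - x | x in X].

(* The partition is spelled out rather than stated with [partition], which
   would only constrain the set of blocks and so would allow A and B (or A and
   the identity block) to coincide. *)
Record representation_3_7 (G : finZmodType) (A B : {set G}) : Prop :=
  Representation37 {
    rep_A_neq0 : A != set0;
    rep_B_neq0 : B != set0;
    rep_disjoint_IdA : [disjoint [set 0] & A];
    rep_disjoint_IdB : [disjoint [set 0] & B];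
    rep_disjoint_AB : [disjoint A & B];
    rep_cover : [set 0] :|: A :|: B = [set: G];
    rep_A_sym : A = oppset A;
    rep_B_sym : B = oppset B;
    rep_AA : sumset A A = [set 0];
    rep_BB : sumset B B = A :|: B :|: [set 0];
    rep_AB : sumset A B = B }.

(* For n > 0, ['I_n.-1.+1] is Z/nZ, including the trivial group for n = 1
   (which ['Z_n] is not); n = 0 is a junk value. *)
Definition representable_3_7 (n : nat) : Prop :=
  exists A B : {set 'I_n.-1.+1}, representation_3_7 A B.

Definition CySp_3_7 : set nat :=
  [set n | (0 < n)%N /\ representable_3_7 n]%classic.

(* Main.v *)
(** [A + A = {0}] forces [A = {h}] with [h] of order two, so [n] is even and
    [B] is the complement of [{0, h}].  If [n > 4] then [2 (n - 2) > n], and by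
    pigeonhole every [g] lies in [B + B] because [B] meets [g - B].  Conversely
    a decomposition [b = x + y] of some [b] in [B] with [x], [y] in [B] makes
    [0, h, b, b + h, x] distinct, so [n > 4]. *)
Require Import Defs.
From mathcomp Require Import classical_sets.
From mathcomp Require Import all_boot all_algebra.
From mathcomp Require Import zify.

Set Implicit Arguments.
Unset Strict Implicit.
Unset Printing Implicit Defensive.

Import GRing.Theory.

Local Open Scope ring_scope.

Section Representations.

Variable G : finZmodType.
Implicit Types (A B : {set G}) (h g : G).

Lemma sumset_full B g : (#|G| < #|B| + #|B|)%N -> g \in sumset B B.
Proof.
move=> ltGB; pose C := [set g - x | x in B].
have cardC : #|C| = #|B| by apply: card_imset => x y /addrI/oppr_inj.
have : (0 < #|B :&: C|)%N.
  (* Inclusion-exclusion: [B] and [C] have [#|B| + #|B|] elements in total, more than their union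
     can hold. *)
  rewrite -(ltn_add2l #|B :|: C|) addn0 cardsUI cardC.
  exact: leq_ltn_trans (max_card _) ltGB.
case/card_gt0P=> y /setIP[By /imsetP[x Bx def_y]].
by apply/imset2P; exists y x; rewrite // def_y subrK.
Qed.

Lemma representation_3_7_of_involution h :
  h != 0 -> h + h = 0 -> (4 < #|G|)%N ->
  representation_3_7 [set h] (~: [set 0; h]).
Proof.
move=> h0 hh ltG; set B := ~: _.
have oppK : - h = h by apply/eqP; rewrite eq_sym -addr_eq0 hh.
have cardB : (#|[set 0%R; h]| + #|B| = #|G|)%N by rewrite cardsC.
have [B_gt0 B_large] : (0 < #|B|)%N /\ (#|G| < #|B| + #|B|)%N.
  by move: cardB ltG; rewrite cards2 eq_sym h0 => <-; case: #|B|; lia.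
have memB x : (x \in B) = (x != 0) && (x != h) by rewrite !inE negb_or.
(* Translation by [h] swaps [0] and [h], hence preserves their complement [B]. *)
have hB x : x \in B -> h + x \in B.
  rewrite !memB => /andP[x0 xh].
  by rewrite addrC addr_eq0 oppK xh -subr_eq0 addrK x0.
split.
- by apply/set0Pn; exists h; rewrite inE.
- by rewrite -card_gt0.
- by rewrite disjoints1 inE eq_sym.
- by rewrite disjoints1 memB eqxx.
- by rewrite disjoints1 memB eqxx andbF.
- exact: setUCr.
- by rewrite /oppset imset_set1 oppK.
- have NB x : x \in B -> - x \in B by rewrite !memB oppr_eq0 eqr_oppLR oppK.
  apply/setP=> x; apply/idP/imsetP => [Bx | [y By ->]]; last exact: NB.
  by exists (- x); rewrite ?opprK ?NB.
- by rewrite /sumset imset2_set1l imset_set1 hh.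
(* Both sides are the whole group. *)
- apply/setP=> x; rewrite sumset_full //.
  by rewrite !inE; case: (x == 0); case: (x == h).
- rewrite /sumset imset2_set1l.
  apply/setP=> x; apply/imsetP/idP => [[y By ->] | Bx]; first exact: hB.
  by exists (h + x); rewrite ?hB // addrA hh add0r.
Qed.

(** With the preceding lemma, this reduces representability over any finite abelian group to having
    an element of order two and more than four elements. *)
Lemma involution_of_representation_3_7 A B :
  representation_3_7 A B ->
  exists h, [/\ h != 0, h + h = 0 & (4 < #|G|)%N].
Proof.
case=> /set0Pn[h Ah] /set0Pn[b Bb].
rewrite !disjoints1 => A0 B0 dAB _ _ _ AA BB AB.
have h0 : h != 0 by apply: contraNneq A0 => <-.
have hh : h + h = 0 by apply/set1P; rewrite -AA; apply: imset2_f.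
have Bh : h \notin B by rewrite (disjointFr dAB Ah).
have Bhb : h + b \in B by rewrite -AB; apply: imset2_f.
exists h; split=> //.
have : b \in sumset B B by rewrite BB !inE Bb orbT.
case/imset2P=> x y Bx By def_b.
have neqB z t : z \in B -> t \notin B -> t == z = false.
  by move=> Bz; apply: contraNF => /eqP->.
suff /card_uniqP card5 : uniq [:: 0; h; b; h + b; x].
  by have := max_card [in [:: 0; h; b; h + b; x]]; rewrite card5.
(* Otherwise [y = 0], which is not in [B]. *)
have xb : (b == x) = false.
  by rewrite def_b -subr_eq0 addrAC subrr add0r; apply: contraNF B0 => /eqP <-.
(* Otherwise [h + y = 0], so [y = - h = h], which is not in [B]. *)
have xhb : (h + b == x) = false.
  rewrite def_b addrCA -subr_eq0 addrAC subrr add0r addr_eq0.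
  apply: contraNF Bh => /eqP def_h.
  by rewrite -(addr0_eq hh) def_h opprK.
have bhb : (b == h + b) = false.
  by rewrite -subr_eq0 opprD addrCA subrr addr0 oppr_eq0 (negPf h0).
rewrite /= !inE !negb_or (eq_sym 0 h) h0.
by rewrite !(neqB _ _ _ B0) // !(neqB _ _ _ Bh) // xb xhb bhb.
Qed.

End Representations.

Lemma representable_3_7P n :
  (0 < n)%N -> representable_3_7 n <-> (4 < n)%N && ~~ odd n.
Proof.
case: n => // n _; split=> [[A [B /involution_of_representation_3_7]] | ].
  case=> h [h0 hh]; rewrite card_ord => -> /=.
  have /dvdnP[q def_q] : (n.+1 %| h + h)%N by have /eqP := congr1 val hh.
  have hgt0 : (0 < h)%N by rewrite lt0n.
  (* As [0 < h < n.+1], the multiple [h + h] of [n.+1] lies strictly between [0] and twice [n.+1];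
     so [q = 1] and the modulus [n.+1] is even. *)
  by have := ltn_ord h; case: q def_q => [|[|q]]; rewrite ?mulSn; lia.
(* Half the modulus is the element of order two. *)
case/andP=> ngt4 even_n; pose h : 'I_n.+1 := inord n.+1./2.
have val_h : val h = n.+1./2 by rewrite /= inordK //; lia.
exists [set h], (~: [set 0; h]); apply: representation_3_7_of_involution.
- by rewrite -val_eqE val_h /=; lia.
- by apply: val_inj; rewrite /= -/(val h) val_h addnn even_halfK ?modnn.
- by rewrite card_ord.
Qed.

Theorem theorem6 :
  (forall n : nat, (6 <= n)%N -> ~~ odd n -> representable_3_7 n) /\
  CySp_3_7 = [set (2 * k)%N | k in [set k : nat | (3 <= k)%N]]%classic.
Proof.
split=> [n nge6 even_n | ].
  by apply/representable_3_7P; [lia | rewrite even_n andbT; lia].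
apply/seteqP; split=> n /=.
  case=> n0 /(representable_3_7P n0)/andP[ngt4 even_n].
  (* An even [n > 4] is at least 6, so its half is at least 3. *)
  by exists n./2; [rewrite /=; lia | lia].
case=> k /= kge3 <-; have n0 : (0 < 2 * k)%N by lia.
by split=> //; apply/representable_3_7P => //; apply/andP; split; lia.
Qed.
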